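(* Let $(V,E,c)$ be a connected network with $V$ countably infinite, and let $\Delta_{Fri}$ be the Friedrichs extension of the graph Laplacian $\Delta$ regarded as an operator in $\mathscr{H}_E$ with domain $\mathscr{D}_E$. A function $u$ on $V$ is in the domain of $\Delta_{Fri}$ if and only if $u$ is in the completion of $\mathscr{D}_E$ with respect to the quadratic form $$\mathscr{D}_E\ni\varphi\longmapsto\langle\varphi,\Delta\varphi\rangle_{\mathscr{H}_E}\in[0,\infty),$$ and $\Delta u\in\mathscr{H}_E$ (where $\Delta u$ is computed pointwise).
   Context: A connected network $(V,E,c)$ consists of a countable set $V$ of vertices; a set $E\subset V\times V$ of edges such that $(x,y)\in E\iff(y,x)\in E$, $(x,x)\notin E$, each $x\in V$ has a finite nonzero number of neighbours $y$ (those with $(x,y)\in E$, written $y\sim x$), and any two vertices are joined by a finite path of edges; and a conductance function $c:E\to(0,\infty)$, $(x,y)\mapsto c_{xy}$, with $c_{xy}=c_{yx}$. The energy Hilbert space $\mathscr{H}_E$ is the space of functions $u:V\to\mathbb{C}$, modulo constant functions, with $\|u\|_{\mathscr{H}_E}^2=\frac12\sum_{(x,y)\in E}c_{xy}|u(x)-u(y)|^2<\infty$, with inner product (conjugate-linear in the first variable) $\langle u,v\rangle_{\mathscr{H}_E}=\frac12\sum_{(x,y)\in E}c_{xy}\overline{(u(x)-u(y))}(v(x)-v(y))$. It is a Hilbert space. A function on $V$ is regarded as an element of $\mathscr{H}_E$ through its class modulo constants. The graph Laplacian is $(\Delta u)(x)=\sum_{y\sim x}c_{xy}(u(x)-u(y))$.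 Fix a base-point $o\in V$ and put $V'=V\setminus\{o\}$. For $x\in V'$, $v_x$ is the unique vector in $\mathscr{H}_E$ with $\langle v_x,u\rangle_{\mathscr{H}_E}=u(x)-u(o)$ for all $u\in\mathscr{H}_E$; it satisfies $\Delta v_x=\delta_x-\delta_o$, with $\delta_x$ the indicator function of $\{x\}$. $\mathscr{D}_E$ is the set of finite linear combinations of $\{v_x:x\in V'\}$; it is dense in $\mathscr{H}_E$, and $\Delta$ with domain $\mathscr{D}_E$ is Hermitian and nonnegative. ''Completion of $\mathscr{D}_E$ with respect to the quadratic form'' is understood in the usual sense of the form closure inside $\mathscr{H}_E$: $u$ belongs to it iff there are $\varphi_n\in\mathscr{D}_E$ with $\|\varphi_n-u\|_{\mathscr{H}_E}\to0$ and $\langle\varphi_n-\varphi_m,\Delta(\varphi_n-\varphi_m)\rangle_{\mathscr{H}_E}\to0$ as $n,m\to\infty$. *)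

(* Defs.v *)
From HB Require Import structures.
From mathcomp Require Import all_boot all_order all_algebra.
From mathcomp Require Import generic_quotient ring_quotient.
From mathcomp Require Import all_classical all_reals all_analysis.
From mathcomp Require Import complex ring.

Set Implicit Arguments.
Unset Strict Implicit.
Unset Printing Implicit Defensive.

Import Order.TTheory GRing.Theory Num.Theory.
Import numFieldNormedType.Exports.
Import Normc.

Local Open Scope classical_set_scope.
Local Open Scope ring_scope.
Local Open Scope complex_scope.
Local Open Scope quotient_scope.

Section Friedrichs.
Context {R : realType} {H : lmodType R[i]}.
Variables (ip : H -> H -> R[i]) (D : set H) (A : H -> H).

Definition hnorm (h : H) : R := Num.sqrt (complex.Re (ip h h)).

Definition form_approx (phi : nat -> H) (u : H) : Prop :=
  [/\ forall n, D (phi n),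
      hnorm (phi n - u) @[n --> \oo] --> (0 : R) &
      (ip (phi nm.1 - phi nm.2) (A (phi nm.1 - phi nm.2)) : R[i]^o)
        @[nm --> filter_prod \oo \oo] --> (0 : R[i]^o)].

Definition form_completion : set H :=
  [set u | exists phi, form_approx phi u].

(* The closed form q~ extending q(v, u) = <v, A u>: q~(v, u) = z, where q~ is
   computed along any approximating sequences. *)
Definition closed_form (v u : H) (z : R[i]) : Prop :=
  forall phi psi, form_approx phi v -> form_approx psi u ->
    (ip (phi n) (A (psi n)) : R[i]^o) @[n --> \oo] --> (z : R[i]^o).

(* The operator associated with the closed form: u is in its domain with
   image w iff q~(v, u) = <v, w> for all v in the form domain. *)
Definition friedrichs_graph : set (H * H) :=
  [set uw | form_completion uw.1 /\
    forall v, form_completion v -> closed_form v uw.1 (ip v uw.2)].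

Definition friedrichs_domain : set H :=
  [set u | exists w, friedrichs_graph (u, w)].

End Friedrichs.

(* cond is only meaningful on edges: its values elsewhere are never used. *)
Record network (R : realType) (V : countType) := Network {
  edge : rel V;
  cond : V -> V -> R;
  edge_sym : symmetric edge;
  edge_irr : irreflexive edge;
  edge_fin : forall x, finite_set [set y | edge x y];
  edge_ex : forall x, exists y, edge x y;
  edge_connected : forall x y, exists p, path edge x p /\ last x p = y;
  cond_gt0 : forall x y, edge x y -> 0 < cond x y;
  cond_sym : forall x y, edge x y -> cond x y = cond y x
}.

Section Sums.
Context {R : realType} {T : choiceType}.

(* Unconditional sums of absolutely summable families. *)
Definition rsum (S : set T) (f : T -> R) : R :=
  fine (\esum_(i in S) (EFin \o f)^\+ i - \esum_(i in S) (EFin \o f)^\- i)%E.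

Definition csum (S : set T) (f : T -> R[i]) : R[i] :=
  rsum S (fun i => complex.Re (f i)) +i* rsum S (fun i => complex.Im (f i)).

End Sums.

Section EnergySpace.
Context {R : realType} {V : countType} (N : network R V).
Local Notation C := R[i].

Definition edges : set (V * V) := [set e | edge N e.1 e.2].

Definition energy (u : V -> C) : \bar R :=
  (2^-1%:E * \esum_(e in edges)
    (cond N e.1 e.2 * normc (u e.1 - u e.2) ^+ 2)%:E)%E.

Definition finite_energy : {pred V -> C} := fun u => (energy u < +oo)%E.

Definition energy_ip (u v : V -> C) : C :=
  2^-1 * csum edges (fun e =>
    (cond N e.1 e.2)%:C * ((u e.1 - u e.2)^* * (v e.1 - v e.2))).

Definition laplacian (u : V -> C) (x : V) : C :=
  \sum_(y \in [set y | edge N x y]) (cond N x y)%:C * (u x - u y).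

Lemma energy_lty u : (u \in finite_energy) =
  (\esum_(e in edges) (cond N e.1 e.2 * normc (u e.1 - u e.2) ^+ 2)%:E < +oo)%E.
Proof.
rewrite /finite_energy /in_mem /= /energy.
have : (0 <= \esum_(e in edges)
    (cond N e.1 e.2 * normc (u e.1 - u e.2) ^+ 2)%:E)%E.
  apply: esum_ge0 => e /= eE; rewrite lee_fin mulr_ge0 ?sqr_ge0//.
  exact/ltW/cond_gt0.
case: (\esum_(_ in _) _)%E => [r| |] //= _; first by rewrite -EFinM !ltry.
by rewrite gt0_muley ?lte_fin.
Qed.

Let normc_sq (z : C) : normc z ^+ 2 = complex.Re z ^+ 2 + complex.Im z ^+ 2.
Proof. by case: z => a b /=; rewrite sqr_sqrtr// addr_ge0 ?sqr_ge0. Qed.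

Let normc_sqD (z w : C) :
  normc (z + w) ^+ 2 <= 2 * normc z ^+ 2 + 2 * normc w ^+ 2.
Proof.
rewrite !normc_sq; case: z w => [a b] [c d] /=.
rewrite -subr_ge0 [leRHS](_ : _ = (a - c) ^+ 2 + (b - d) ^+ 2).
  by rewrite addr_ge0 ?sqr_ge0.
by ring.
Qed.

Let ge0_term (u : V -> C) e : edges e ->
  (0 <= (cond N e.1 e.2 * normc (u e.1 - u e.2) ^+ 2)%:E)%E.
Proof.
by move=> eE; rewrite lee_fin mulr_ge0 ?sqr_ge0//; exact/ltW/cond_gt0.
Qed.

Let esumZ_lty (k : R) (f : V * V -> R) : 0 <= k ->
  (forall e, edges e -> 0 <= f e) ->
  (\esum_(e in edges) (f e)%:E < +oo)%E ->
  (\esum_(e in edges) (k * f e)%:E < +oo)%E.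
Proof.
move=> k0 f0 foo.
apply: (@le_lt_trans _ _ (k%:E * \esum_(e in edges) (f e)%:E)%E); last first.
  by rewrite lte_mul_pinfty// ge0_fin_numE// esum_ge0// => e /f0;
    rewrite lee_fin.
apply: ge_ereal_sup => _ [F [finF FE] <-].
rewrite fsbig_finite//= sumEFin -mulr_sumr EFinM lee_wpmul2l ?lee_fin//.
rewrite -sumEFin -fsbig_finite//.
by apply: ereal_sup_ubound; exists F.
Qed.

Fact finite_energy_submod : subsemimod_closed finite_energy.
Proof.
split; [split|].
- rewrite energy_lty esum1 ?ltry// => e _.
  by rewrite subrr normc0 expr0n mulr0.
- move=> u v; rewrite !energy_lty => fu fv.
  have term0 w e : edges e ->
      0 <= cond N e.1 e.2 * normc (w e.1 - w e.2) ^+ 2.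
    by move=> /(@ge0_term w); rewrite lee_fin.
  have two0 w e : edges e ->
      (0 <= (2 * (cond N e.1 e.2 * normc (w e.1 - w e.2) ^+ 2))%:E)%E.
    by move=> eE; rewrite lee_fin mulr_ge0// term0.
  have := lte_add_pinfty (esumZ_lty (ler0n _ 2) (term0 u) fu)
    (esumZ_lty (ler0n _ 2) (term0 v) fv).
  rewrite -esumD//; [|exact: two0|exact: two0].
  apply: le_lt_trans; apply: le_esum => e eE.
  rewrite -EFinD lee_fin !mulrA ![2 * _]mulrC -!mulrA -mulrDr.
  rewrite ler_wpM2l ?(ltW (cond_gt0 _))//.
  rewrite [X in normc X](_ : _ = (u e.1 - u e.2) + (v e.1 - v e.2)).
    exact: normc_sqD.
  by rewrite /= opprD addrACA.
- move=> a u; rewrite !energy_lty => fu.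
  have := esumZ_lty (sqr_ge0 (normc a)) _ fu.
  move=> /(_ _)/wrap[e eE|]; first by rewrite -lee_fin ge0_term.
  apply: le_lt_trans; apply: le_esum => e eE.
  by rewrite -scalerBr normcM exprMn mulrCA.
Qed.

HB.instance Definition _ := GRing.isSubmodClosed.Build C (V -> C)
  finite_energy finite_energy_submod.

Record finite_energy_fun := FiniteEnergyFun {
  fefun :> V -> C;
  fefunP : fefun \in finite_energy
}.

HB.instance Definition _ := [isSub for fefun].
HB.instance Definition _ := [Choice of finite_energy_fun by <:].
HB.instance Definition _ := [SubChoice_isSubLmodule of finite_energy_fun by <:].

Definition constant_fun : {pred finite_energy_fun} :=
  fun u => `[< exists a : C, forall x, u x = a >].

Fact constant_fun_zmod : zmod_closed constant_fun.
Proof.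
split=> [|u v /asboolP[a ua] /asboolP[b vb]]; apply/asboolP.
  by exists 0.
by exists (a - b) => x; rewrite -(ua x) -(vb x).
Qed.

HB.instance Definition _ := GRing.isZmodClosed.Build finite_energy_fun
  constant_fun constant_fun_zmod.

(* The energy space: functions of finite energy modulo constants. *)
Definition HE : Type := Quotient.quot constant_fun.
HB.instance Definition _ := GRing.Zmodule.on HE.
HB.instance Definition _ := EqQuotient.on HE.

Definition to_HE (u : finite_energy_fun) : HE := \pi_HE u.

Lemma to_HE_eq u v :
  to_HE u = to_HE v <-> exists a : C, forall x, u x - v x = a.
Proof.
rewrite /to_HE; split => [/eqmodP|uv].
  by rewrite /Quotient.equiv => /asboolP.
by apply/eqmodP; apply/asboolP.
Qed.

Lemma to_HE_add u v : to_HE (u + v) = to_HE u + to_HE v.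
Proof. exact: Quotient.pi_add. Qed.

Lemma reprHE (h : HE) : to_HE (repr h) = h.
Proof. exact: reprK. Qed.

Definition scale_HE (a : C) (h : HE) : HE := to_HE (a *: repr h).

Lemma to_HE_scale a u : to_HE (a *: u) = scale_HE a (to_HE u).
Proof.
apply/to_HE_eq; have /to_HE_eq[b ub] := esym (reprHE (to_HE u)).
by exists (a * b) => x; rewrite -(ub x) mulrBr.
Qed.

Fact scale_HE_A a b h : scale_HE a (scale_HE b h) = scale_HE (a * b) h.
Proof. by rewrite -[h]reprHE -!to_HE_scale scalerA. Qed.

Fact scale_HE_1 : left_id 1 scale_HE.
Proof. by move=> h; rewrite -[h]reprHE -!to_HE_scale scale1r. Qed.

Fact scale_HE_Dr : right_distributive scale_HE +%R.
Proof.
move=> a h k; rewrite -[h]reprHE -[k]reprHE.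
by rewrite -to_HE_add -!to_HE_scale -to_HE_add scalerDr.
Qed.

Fact scale_HE_Dl h : {morph scale_HE^~ h : a b / a + b}.
Proof.
by move=> a b; rewrite -[h]reprHE -!to_HE_scale -to_HE_add scalerDl.
Qed.

HB.instance Definition _ := GRing.Zmodule_isLmodule.Build C HE
  scale_HE_A scale_HE_1 scale_HE_Dr scale_HE_Dl.

(* The inner product only involves differences, so the choice of the
   representatives is immaterial. *)
Definition ip_HE (h k : HE) : C := energy_ip (repr h) (repr k).

Lemma ip_HE_to_HE u v : ip_HE (to_HE u) (to_HE v) = energy_ip u v.
Proof.
have dif w x y : (repr (to_HE w)) x - (repr (to_HE w)) y = w x - w y.
  have /to_HE_eq[a wa] := reprHE (to_HE w).
  have /eqP := wa x; rewrite subr_eq => /eqP ->.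
  by have /eqP := wa y; rewrite subr_eq => /eqP ->; ring.
rewrite /ip_HE /energy_ip; congr (_ * csum _ _); apply/funext => e.
by rewrite !dif.
Qed.

(* A function is identified with its class, which exists iff its energy is
   finite: in_HE S u means that u has finite energy and its class is in S. *)
Definition in_HE (S : set HE) (u : V -> C) : Prop :=
  exists2 f : finite_energy_fun, u = f & S (to_HE f).

(* The Laplacian as an operator in HE; the value is only meaningful (and not
   a default) when the pointwise Laplacian has finite energy, as is the case on
   the span of the dipoles. *)
Definition laplacian_HE (h : HE) : HE :=
  to_HE (insubd 0 (laplacian (repr h))).

Variable o : V.

Definition dipole (x : V) (v : HE) : Prop :=
  forall u : finite_energy_fun, ip_HE v (to_HE u) = u x - u o.

Definition dipole_span : set HE :=
  [set h | exists (n : nat) (a : 'I_n -> C) (x : 'I_n -> V) (v : 'I_n -> HE),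
    (forall i, x i != o /\ dipole (x i) (v i)) /\ h = \sum_(i < n) a i *: v i].

End EnergySpace.

Arguments ip_HE {R V} N h k.
Arguments laplacian_HE {R V} N h.
Arguments dipole {R V} N o x v.
Arguments dipole_span {R V} N o.

(* Main.v *)
Require Import Defs.
From mathcomp Require Import all_boot all_order all_algebra.
From mathcomp Require Import all_classical all_reals all_analysis.
From mathcomp Require Import complex.
From mathcomp Require Import ring lra.

Set Implicit Arguments.
Unset Strict Implicit.
Unset Printing Implicit Defensive.

Import Order.TTheory GRing.Theory Num.Theory.
Import numFieldNormedType.Exports.
Import Normc.

Local Open Scope classical_set_scope.
Local Open Scope ring_scope.

(** The Friedrichs extension of a positive symmetric operator is the restriction
of its adjoint to the form domain (friedrichs_graphE).  So the theorem reduces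
to computing the adjoint of the Laplacian with domain the span of the dipoles,
and this adjoint is the pointwise Laplacian modulo constants
(adjoint_laplacianP).

The computation rests on two reproducing properties of the energy form.  The
indicator of x represents the functional sending u to the value at x of its
Laplacian (energy_form_delta), and the dipole at x represents the difference
u x - u o.  Hence the Laplacian of the dipole at x is the difference of the
indicators of x and o, and for every w of finite energy the adjoint relation
tested on that dipole says that the Laplacian of u and w have the same
difference between x and o.  If this holds for all x, the Laplacian of u is w
up to a constant, so it has finite energy; conversely, if the Laplacian of u has
finite energy, it can be taken as w.  The same formulas show that the Laplacian
is symmetric on the dipole span, and that its form there is the squared l^2 norm
of the Laplacian, hence nonnegative (laplacian_positive_symmetric).

Testing on dipoles is conclusive only if they exist.  The dipole at x is obtained
by minimizing the energy under the constraint u x - u o = 1 (dipole_exists):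
differences of values are bounded by the energy because the network is
connected (evaluation_bounded), so minimizing sequences converge pointwise, and
the energy is lower semicontinuous for pointwise convergence
(energy_le_of_pointwise_limit). *)

(** * Complex numbers *)

Section ComplexNumbers.
Context {R : realType}.
Implicit Types (z w : R[i]) (p q : R).
Local Open Scope complex_scope.

Lemma sqr_normc z : normc z ^+ 2 = complex.Re z ^+ 2 + complex.Im z ^+ 2.
Proof. by case: z => a b /=; rewrite sqr_sqrtr// addr_ge0 ?sqr_ge0. Qed.

Lemma normc_ge0 z : 0 <= normc z.
Proof. by case: z => a b; exact: sqrtr_ge0. Qed.

Lemma normcE z : `|z| = (normc z)%:C.
Proof. by []. Qed.

Lemma normcD z w : normc (z + w) <= normc z + normc w.
Proof. by have := ler_normD z w; rewrite !normcE -rmorphD/= lecR. Qed.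

Lemma normcN z : normc (- z) = normc z.
Proof. by have /complexI := normrN z. Qed.

Lemma normcB z w : normc (z - w) = normc (w - z).
Proof. by rewrite -normcN opprB. Qed.

Lemma ReM z w : complex.Re (z * w) =
  complex.Re z * complex.Re w - complex.Im z * complex.Im w.
Proof. by case: z w => [a b] [c d]. Qed.

Lemma ImM z w : complex.Im (z * w) =
  complex.Re z * complex.Im w + complex.Im z * complex.Re w.
Proof. by case: z w => [a b] [c d]. Qed.

Lemma ReD z w : complex.Re (z + w) = complex.Re z + complex.Re w.
Proof. by case: z w => [a b] [c d]. Qed.

Lemma ImD z w : complex.Im (z + w) = complex.Im z + complex.Im w.
Proof. by case: z w => [a b] [c d]. Qed.

Lemma ReB z w : complex.Re (z - w) = complex.Re z - complex.Re w.
Proof. by case: z w => [a b] [c d]. Qed.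

Lemma ImB z w : complex.Im (z - w) = complex.Im z - complex.Im w.
Proof. by case: z w => [a b] [c d]. Qed.

Lemma ReJ z : complex.Re (conjc z) = complex.Re z.
Proof. by case: z. Qed.

Lemma ImJ z : complex.Im (conjc z) = - complex.Im z.
Proof. by case: z. Qed.

Lemma ReR p : complex.Re p%:C = p. Proof. by []. Qed.
Lemma ImR p : complex.Im p%:C = 0. Proof. by []. Qed.

Lemma complexP z w :
  complex.Re z = complex.Re w -> complex.Im z = complex.Im w -> z = w.
Proof. by case: z w => [a b] [c d] /= -> ->. Qed.

Lemma conjcD z w : conjc (z + w) = conjc z + conjc w.
Proof. exact: rmorphD. Qed.

Lemma conjcM z w : conjc (z * w) = conjc z * conjc w.
Proof. exact: rmorphM. Qed.

Lemma normcJ z : normc (conjc z) = normc z.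
Proof. by case: z => a b /=; rewrite sqrrN. Qed.

Lemma Re_le_normc z : `|complex.Re z| <= normc z.
Proof.
case: z => a b /=; rewrite -sqrtr_sqr ler_wsqrtr// lerDl sqr_ge0//.
Qed.

Lemma Im_le_normc z : `|complex.Im z| <= normc z.
Proof.
by case: z => a b /=; rewrite -sqrtr_sqr ler_wsqrtr// lerDr sqr_ge0.
Qed.

(** Along the line t = - s * conjc z with s real, the hypothesis is about a
quadratic polynomial in s; its minimum, at s = 1 / q, gives the bound. *)
Lemma discriminant_le p q z : 0 <= p -> 0 <= q ->
  (forall t : R[i], 0 <= p + 2 * complex.Re (t * z) + normc t ^+ 2 * q) ->
  normc z ^+ 2 <= p * q.
Proof.
move=> p0 q0 H.
have {}H s : 0 <= p - 2 * s * normc z ^+ 2 + s ^+ 2 * normc z ^+ 2 * q.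
  have := H (- s%:C * conjc z); congr (is_true (0 <= _)).
  by rewrite !sqr_normc; case: z {H} => a b /=; ring.
have z0 : 0 <= normc z ^+ 2 by rewrite sqr_ge0.
move: z0 H; move: (normc z ^+ 2) => y y0 H.
move: q0; rewrite le_eqVlt => /predU1P[q0|q0]; last first.
  have := H q^-1.
  rewrite [leRHS](_ : _ = (p * q - y) / q); last by field; lra.
  by rewrite pmulr_lge0 ?invr_gt0// subr_ge0.
(* If q = 0 the polynomial is affine in s and cannot stay nonnegative. *)
rewrite -q0 mulr0; rewrite leNgt; apply/negP => y1.
have := H ((p + 1) / y).
rewrite -q0 mulr0 addr0.
rewrite [leRHS](_ : _ = - p - 2); last by field; lra.
lra.
Qed.

(** Convergence in the complex numbers, whose norm takes complex values, read
with real radii. *)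
Lemma cvgcP (f : nat -> R[i]) z :
  ((f n : R[i]^o) @[n --> \oo] --> (z : R[i]^o)) <->
  (forall e : R, 0 < e -> exists N, forall n, (N <= n)%N -> normc (z - f n) < e).
Proof.
split=> [/cvgrPdist_lt H e e0|H].
  have /= := H e%:C; rewrite ltcR => /(_ e0)[N _ HN].
  by exists N => n /HN /=; rewrite normcE ltcR.
apply/cvgrPdist_lt => -[e b]; rewrite ltcE/= => /andP[/eqP -> e0].
have [N HN] := H e e0.
by exists N => // n /HN /=; rewrite normcE ltcR.
Qed.

(** Completeness of the complex plane, deduced from that of the real line
coordinate by coordinate. *)
Lemma complex_cauchy_cvg (f : nat -> R[i]) :
  (forall e : R, 0 < e -> exists M, forall n m, (M <= n)%N -> (M <= m)%N ->
    normc (f n - f m) < e) ->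
  exists z, forall e : R, 0 < e -> exists M, forall n, (M <= n)%N ->
    normc (z - f n) < e.
Proof.
move=> fC.
have part (p : R[i] -> R) : (forall z w, p (z - w) = p z - p w) ->
    (forall z, `|p z| <= normc z) ->
    exists l : R, p (f n) @[n --> \oo] --> l.
  move=> pB ple.
  suff /cvg_ex[l fl] : cvg (p (f n) @[n --> \oo]) by exists l.
  apply/cauchy_cvgP/cauchyP => /= e e0.
  have [M HM] := fC e e0.
  exists (p (f M)); exists M => // n /= Mn.
  by rewrite /ball/= -pB; apply: le_lt_trans (ple _) _; exact: HM.
have [a fa] := part _ ReB Re_le_normc.
have [b fb] := part _ ImB Im_le_normc.
exists (a +i* b) => e e0.
have e2 : 0 < e / 2 by rewrite divr_gt0.
have [M1 _ HM1] := proj1 (@cvgrPdist_lt _ _ _ _ _ _ _) fa _ e2.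
have [M2 _ HM2] := proj1 (@cvgrPdist_lt _ _ _ _ _ _ _) fb _ e2.
exists (maxn M1 M2) => n; rewrite geq_max => /andP[/HM1 /= n1 /HM2 /= n2].
rewrite -(@ltr_pXn2r _ 2)// ?nnegrE ?normc_ge0 ?(ltW e0)// sqr_normc.
have sqr_lt (x : R) : `|x| < e / 2 -> x ^+ 2 < e ^+ 2 / 4.
  rewrite ltr_norml -subr_gt0 -[x < _]subr_gt0 => /andP[x1 x2].
  by have := mulr_gt0 x1 x2; rewrite !expr2; lra.
have := sqr_lt _ n1; have := sqr_lt _ n2; rewrite ReB ImB /=.
by have := exprn_gt0 2 e0; lra.
Qed.

Lemma cvg_sqr_normc (f : nat -> R[i]) z :
  (forall e : R, 0 < e -> exists M, forall n, (M <= n)%N -> normc (z - f n) < e) ->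
  (normc (f n) ^+ 2 @[n --> \oo] --> (normc z ^+ 2 : R)).
Proof.
move=> fz; rewrite expr2; under eq_fun do rewrite expr2.
suff fz' : normc (f n) @[n --> \oo] --> normc z by exact: cvgM.
apply/cvgrPdist_lt => e /fz[M HM]; exists M => // n /HM; apply: le_lt_trans.
have := normcD (z - f n) (f n); have := normcD (f n - z) z.
by rewrite !subrK normcB => h1 h2; rewrite ler_norml; lra.
Qed.

End ComplexNumbers.

(** * Positive symmetric operators and their Friedrichs extensions *)

Section AssociatedOperator.
Context {R : realType} {H : lmodType R[i]}.
Local Open Scope complex_scope.

(** Definiteness is left out so that the notion also covers the energy form on
functions, before constants are divided out. *)
Record semi_inner (ip : H -> H -> R[i]) : Prop := SemiInner {
  ipDr : forall u v w, ip u (v + w) = ip u v + ip u w;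
  ipZr : forall a u v, ip u (a *: v) = a * ip u v;
  ipJ : forall u v, conjc (ip u v) = ip v u;
  ip_ge0 : forall u, 0 <= complex.Re (ip u u)
}.

Record positive_symmetric (ip : H -> H -> R[i]) (D : set H) (A : H -> H)
    : Prop := PositiveSymmetric {
  domD : forall u v, D u -> D v -> D (u + v);
  domZ : forall a u, D u -> D (a *: u);
  opD : forall u v, D u -> D v -> A (u + v) = A u + A v;
  opZ : forall a u, D u -> A (a *: u) = a *: A u;
  op_sym : forall u v, D u -> D v -> ip u (A v) = ip (A u) v;
  op_ge0 : forall u, D u -> 0 <= complex.Re (ip u (A u))
}.

Variable ip : H -> H -> R[i].
Hypothesis ip_semi : semi_inner ip.

Lemma ipDl u v w : ip (u + v) w = ip u w + ip v w.
Proof.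
by rewrite -(ipJ ip_semi) (ipDr ip_semi) conjcD !(ipJ ip_semi).
Qed.

Lemma ipZl a u v : ip (a *: u) v = conjc a * ip u v.
Proof.
by rewrite -(ipJ ip_semi) (ipZr ip_semi) conjcM (ipJ ip_semi).
Qed.

Lemma ipBr u v w : ip u (v - w) = ip u v - ip u w.
Proof. by rewrite -scaleN1r (ipDr ip_semi) (ipZr ip_semi) mulN1r. Qed.

Lemma ipBl u v w : ip (u - v) w = ip u w - ip v w.
Proof.
rewrite -scaleN1r ipDl ipZl (_ : conjc (-1) = -1) ?mulN1r//.
exact: (rmorphN1 (@conjc R)).
Qed.

Lemma ip0r u : ip u 0 = 0.
Proof. by rewrite -(scale0r (0 : H)) (ipZr ip_semi) mul0r. Qed.

Section Form.
Variables (D : set H) (A : H -> H).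
Hypothesis A_pos : positive_symmetric ip D A.

Let q u := complex.Re (ip u (A u)).

Lemma domB u v : D u -> D v -> D (u - v).
Proof.
move=> Du Dv; rewrite -scaleN1r.
by apply: (domD A_pos) => //; exact: (domZ A_pos).
Qed.

Lemma opB u v : D u -> D v -> A (u - v) = A u - A v.
Proof.
move=> Du Dv; have DNv := domZ A_pos (-1) Dv.
by rewrite -[in LHS]scaleN1r (opD A_pos)// (opZ A_pos)// scaleN1r.
Qed.

Lemma formDZ u v (t : R[i]) : D u -> D v ->
  q (u + t *: v) = q u + 2 * complex.Re (t * ip u (A v)) + normc t ^+ 2 * q v.
Proof.
move=> Du Dv; have Dtv : D (t *: v) by exact: (domZ A_pos).
rewrite /q (opD A_pos)// (opZ A_pos)// ipDl !(ipDr ip_semi) !ipZl !(ipZr ip_semi).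
have -> : ip v (A u) = conjc (ip u (A v)).
  by rewrite (ipJ ip_semi) (op_sym A_pos).
rewrite !(ReD, ReM, ImM, ReJ, ImJ) sqr_normc.
have -> : complex.Im (ip v (A v)) = 0.
  have := ipJ ip_semi v (A v); rewrite -(op_sym A_pos)//.
  by case: (ip v _) => a b /= [bb]; lra.
by ring.
Qed.

(** Cauchy-Schwarz for the form attached to a positive symmetric operator; the
identity operator gives the inequality for the inner product itself. *)
Lemma form_cauchy_schwarz u v : D u -> D v ->
  normc (ip u (A v)) ^+ 2 <= q u * q v.
Proof.
move=> Du Dv; apply: discriminant_le.
- exact: (op_ge0 A_pos).
- exact: (op_ge0 A_pos).
move=> t; rewrite -formDZ//; apply: (op_ge0 A_pos).
by apply: (domD A_pos) => //; exact: (domZ A_pos).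
Qed.

Lemma formD_le u v : D u -> D v -> q (u + v) <= 2 * q u + 2 * q v.
Proof.
move=> Du Dv.
have : 0 <= q (u - v) by exact: (op_ge0 A_pos (domB Du Dv)).
rewrite -scaleN1r formDZ//.
rewrite -[v in q (u + v)]scale1r formDZ//.
rewrite normcN normc1 mulN1r mul1r expr1n.
case: (ip u (A v)) => a b /=; lra.
Qed.

End Form.

Lemma id_positive_symmetric : positive_symmetric ip setT id.
Proof. by split=> // u _; exact: (ip_ge0 ip_semi). Qed.

Lemma hnorm_ge0 u : 0 <= hnorm ip u.
Proof. exact: sqrtr_ge0. Qed.

Lemma sqr_hnorm u : hnorm ip u ^+ 2 = complex.Re (ip u u).
Proof. by rewrite sqr_sqrtr// (ip_ge0 ip_semi). Qed.

Lemma cauchy_schwarz u v : normc (ip u v) <= hnorm ip u * hnorm ip v.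
Proof.
rewrite -(@ler_pXn2r _ 2)// ?nnegrE ?mulr_ge0 ?hnorm_ge0 ?normc_ge0//.
rewrite exprMn !sqr_hnorm.
exact: (form_cauchy_schwarz id_positive_symmetric).
Qed.

Lemma cvg_ipr (psi : nat -> H) u h :
  hnorm ip (psi n - u) @[n --> \oo] --> (0 : R) ->
  (ip h (psi n) : R[i]^o) @[n --> \oo] --> (ip h u : R[i]^o).
Proof.
move=> /cvgrPdist_lt psiu; apply/cvgcP => e e0.
have K0 : 0 < hnorm ip h + 1 by rewrite ltr_wpDl ?hnorm_ge0.
have [N _ HN] := psiu (e / (hnorm ip h + 1)) (divr_gt0 e0 K0).
exists N => n /HN /=; rewrite sub0r normrN ger0_norm ?hnorm_ge0// => psin.
rewrite normcB -ipBr; apply: le_lt_trans (cauchy_schwarz _ _) _.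
apply: (@le_lt_trans _ _ ((hnorm ip h + 1) * hnorm ip (psi n - u))).
  by rewrite ler_wpM2r ?hnorm_ge0// lerDl.
by rewrite mulrC -ltr_pdivlMr.
Qed.

Lemma cvg_ipl (psi : nat -> H) u h :
  hnorm ip (psi n - u) @[n --> \oo] --> (0 : R) ->
  (ip (psi n) h : R[i]^o) @[n --> \oo] --> (ip u h : R[i]^o).
Proof.
move=> psiu; have {}psiu := proj1 (cvgcP _ _) (cvg_ipr (h := h) psiu).
apply/cvgcP => e /psiu[N HN]; exists N => n.
move=> /HN; rewrite -(ipJ ip_semi h u) -(ipJ ip_semi h).
by rewrite -normcJ; congr (normc _ < _); exact: rmorphB.
Qed.

Section Friedrichs.
Variables (D : set H) (A : H -> H).
Hypothesis A_pos : positive_symmetric ip D A.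

Lemma form_approx_cauchy phi u (e : R) : form_approx ip D A phi u -> 0 < e ->
  exists N, forall n m, (N <= n)%N -> (N <= m)%N ->
    complex.Re (ip (phi n - phi m) (A (phi n - phi m))) < e.
Proof.
move=> [_ _ /cvgrPdist_lt phiC] e0.
have /= := phiC e%:C; rewrite ltcR => /(_ e0)[[P Q] /=].
move=> [[N1 _ HN1] [N2 _ HN2] PQ].
exists (maxn N1 N2) => n m; rewrite !geq_max => /andP[n1 n2] /andP[m1 m2].
have := PQ (n, m) (conj (HN1 _ n1) (HN2 _ m2)).
rewrite /= sub0r normrN normcE ltcR; apply: le_lt_trans.
by apply: le_trans (Re_le_normc _); rewrite ler_norm.
Qed.

Lemma form_approx_bounded phi u : form_approx ip D A phi u ->
  exists2 K : R, 0 < K & exists N, forall n, (N <= n)%N ->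
    complex.Re (ip (phi n) (A (phi n))) <= K.
Proof.
move=> phiu; have [N HN] := form_approx_cauchy phiu ltr01.
have [Dphi _ _] := phiu.
have q0 := op_ge0 A_pos (Dphi N).
exists (2 + 2 * complex.Re (ip (phi N) (A (phi N)))); first by lra.
exists N => n Nn; rewrite -[phi n](subrK (phi N)).
apply: le_trans (formD_le A_pos (domB A_pos (Dphi n) (Dphi N)) (Dphi N)) _.
have := HN n N Nn (leqnn N); lra.
Qed.

Lemma form_approx_cst phi : D phi -> form_approx ip D A (fun=> phi) phi.
Proof.
move=> Dphi; have A0 : A 0 = 0 by rewrite -(subrr phi) (opB A_pos)// !subrr.
split=> //=; rewrite subrr.
  by rewrite /hnorm ip0r sqrtr0; exact: cvg_cst.
by rewrite A0 ip0r; exact: cvg_cst.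
Qed.

(** The Friedrichs extension is the restriction of the adjoint of A to the form
domain.  Testing the closed form on a constant sequence in D, symmetry moves A
to the left and the limit only involves the inner product; this gives the
adjoint relation.  Conversely the adjoint relation identifies the limit of
ip (phi n) (A (psi m)) in m for fixed n with ip (phi n) w, and Cauchy-Schwarz
for the form bounds the change from m to n uniformly, because phi is bounded
and psi is Cauchy for the form. *)
Lemma friedrichs_graphE u w : form_completion ip D A u ->
  friedrichs_graph ip D A (u, w) <->
  forall phi, D phi -> ip (A phi) u = ip phi w.
Proof.
move=> Qu; split=> [[_ uw] phi Dphi|uw].
  have [psi psiu] := Qu; have [Dpsi psi_u _] := psiu.
  have phiQ : form_completion ip D A phi.
    by exists (fun=> phi); exact: form_approx_cst.
  have := uw _ phiQ _ _ (form_approx_cst Dphi) psiu.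
  have -> : (fun n => ip phi (A (psi n))) = (fun n => ip (A phi) (psi n)).
    by apply/funext => n; rewrite (op_sym A_pos).
  by move=> /(cvg_unique _ (cvg_ipr psi_u)) ->.
split=> //= v _ phi psi phiv psiu.
have [Dphi phi_v _] := phiv; have [Dpsi psi_u _] := psiu.
apply/cvgcP => e e0.
have e3 : 0 < e / 3 by rewrite divr_gt0.
have [N1 HN1] := proj1 (cvgcP _ _) (cvg_ipl (h := w) phi_v) _ e3.
have [K K0 [N2 HN2]] := form_approx_bounded phiv.
have e3K : 0 < (e / 3) ^+ 2 / K by rewrite divr_gt0 ?exprn_gt0.
have [N3 HN3] := form_approx_cauchy psiu e3K.
exists (maxn N1 (maxn N2 N3)) => n; rewrite !geq_max => /and3P[n1 n2 n3].
(* The index m depends on n and is large enough to use the adjoint relation. *)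
have [N4 HN4] := proj1 (cvgcP _ _) (cvg_ipr (h := A (phi n)) psi_u) _ e3.
pose m := maxn N3 N4.
have := HN1 n n1; have := HN4 m (leq_maxr _ _).
rewrite uw// -(op_sym A_pos)//.
have : normc (ip (phi n) (A (psi m - psi n))) < e / 3.
  rewrite -(@ltr_pXn2r _ 2)// ?nnegrE ?normc_ge0 ?(ltW e3)//.
  have Dmn := domB A_pos (Dpsi m) (Dpsi n).
  apply: le_lt_trans (form_cauchy_schwarz A_pos (Dphi n) Dmn) _.
  have := HN3 m n (leq_maxl _ _) n3; rewrite ltr_pdivlMr// mulrC.
  apply: le_lt_trans; rewrite ler_wpM2r ?HN2//.
  exact: (op_ge0 A_pos).
rewrite (opB A_pos)// ipBr.
move: (ip v w) (ip (phi n) w) (ip _ (A (psi m))) (ip _ (A (psi n))).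
move=> a b c d cd bc ab.
have -> : a - d = (a - b) + ((b - c) + (c - d)) by ring.
apply: le_lt_trans (normcD _ _) _.
have := normcD (b - c) (c - d); lra.
Qed.

End Friedrichs.

End AssociatedOperator.

(** * Representing functionals by norm minimizers *)

Section NormMinimizers.
Context {R : realType} {H : lmodType R[i]}.
Local Open Scope complex_scope.
Variables (ip : H -> H -> R[i]) (L : H -> R[i]).
Hypothesis ip_semi : semi_inner ip.
Hypothesis LD : forall u v, L (u + v) = L u + L v.
Hypothesis LZ : forall a u, L (a *: u) = a * L u.
Let idP := id_positive_symmetric ip_semi.

Lemma sqr_hnormDZ u v (t : R[i]) : hnorm ip (u + t *: v) ^+ 2 =
  hnorm ip u ^+ 2 + 2 * complex.Re (t * ip u v) + normc t ^+ 2 * hnorm ip v ^+ 2.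
Proof. by rewrite !sqr_hnorm//; exact: (formDZ ip_semi idP). Qed.

(** First variation: perturbing m inside the affine hyperplane L = 1 cannot
decrease the norm, so m is orthogonal to the kernel of L. *)
Lemma minimizer_represents m : L m = 1 ->
  (forall h, L h = 1 -> hnorm ip m ^+ 2 <= hnorm ip h ^+ 2) ->
  forall h, ip m h = L h * ip m m.
Proof.
move=> Lm m_min h; pose k := h - L h *: m.
have Lk : L k = 0 by rewrite /k -scaleN1r LD !LZ Lm mulr1 mulN1r subrr.
have : normc (ip m k) ^+ 2 <= 0 * hnorm ip k ^+ 2.
  apply: discriminant_le => //; first exact: sqr_ge0.
  move=> t; rewrite add0r.
  have := m_min (m + t *: k); rewrite LD LZ Lk mulr0 addr0 => /(_ Lm).
  by rewrite sqr_hnormDZ -addrA lerDl.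
rewrite mul0r => mk; have /eq0_normc : normc (ip m k) = 0.
  by apply/eqP; rewrite -sqrf_eq0 eq_le mk sqr_ge0.
by rewrite /k (ipBr ip_semi) (ipZr ip_semi) => /subr0_eq.
Qed.

(** Parallelogram identity: the midpoint of u and v still satisfies L = 1, so
its norm is at least the infimum. *)
Lemma almost_minimizers_close (d a b : R) u v :
  (forall h, L h = 1 -> d <= hnorm ip h ^+ 2) -> L u = 1 -> L v = 1 ->
  hnorm ip u ^+ 2 <= d + a -> hnorm ip v ^+ 2 <= d + b ->
  hnorm ip (u - v) ^+ 2 <= 2 * a + 2 * b.
Proof.
move=> d_min Lu Lv ua vb.
have two_neq0 : (2 : R[i]) != 0 by rewrite pnatr_eq0.
have := d_min (2^-1 *: (u + 1 *: v)).
rewrite scale1r LZ LD Lu Lv -[1 + 1]/(2 : R[i]) mulVf// => /(_ erefl).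
have -> : hnorm ip (2^-1 *: (u + v)) ^+ 2 = hnorm ip (u + v) ^+ 2 / 4.
  rewrite -[2^-1 *: _]add0r sqr_hnormDZ !sqr_hnorm// (ip0r ip_semi).
  rewrite -(ipJ ip_semi) (ip0r ip_semi) (rmorph0 (@conjc R)) mulr0
    (_ : complex.Re 0 = 0)// mulr0 !add0r.
  rewrite normcV (_ : normc 2 = 2); first by field.
  rewrite -[2 : R[i]]/((2 : R) +i* (0 + 0)) /= addr0 expr0n addr0.
  by rewrite sqrtr_sqr ger0_norm.
have -> : u - v = u + (-1) *: v by rewrite scaleN1r.
rewrite -[v in u + v]scale1r !sqr_hnormDZ normcN normc1 mulN1r mul1r expr1n.
by case: (ip u v) => x y /=; lra.
Qed.

End NormMinimizers.

(** * Unconditional sums *)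

Section UnconditionalSums.
Context {R : realType} {T : choiceType}.
Implicit Types (S F : set T) (f g h : T -> R).

Lemma esumZ S (k : R) f : 0 <= k -> (forall i, S i -> 0 <= f i) ->
  (\esum_(i in S) (k * f i)%:E = k%:E * \esum_(i in S) (f i)%:E)%E.
Proof.
have le_esumZ (l : R) (g : T -> R) : 0 <= l ->
    (\esum_(i in S) (l * g i)%:E <= l%:E * \esum_(i in S) (g i)%:E)%E.
  move=> l0; apply: ge_ereal_sup => _ [F [finF FS] <-].
  rewrite fsbig_finite//= sumEFin -mulr_sumr EFinM lee_wpmul2l ?lee_fin//.
  by rewrite -sumEFin -fsbig_finite//; apply: ereal_sup_ubound; exists F.
rewrite le_eqVlt => /predU1P[<- _|k0 f0].
  by rewrite mul0e esum1// => i _; rewrite mul0r.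
apply/eqP; rewrite eq_le le_esumZ ?(ltW k0)//=.
have kV0 : 0 <= k^-1 by rewrite invr_ge0 ltW.
have := le_esumZ _ (fun i => k * f i) kV0.
rewrite (eq_esum (b := fun i => (f i)%:E)); last first.
  by move=> i _; rewrite mulKf// gt_eqF.
by rewrite -(@lee_pmul2l _ k%:E)// ?lte_fin// muleA -EFinM divff ?gt_eqF// mul1e.
Qed.

Lemma esum_finite_support S F (f : T -> \bar R) : finite_set F -> F `<=` S ->
  (forall i, F i -> (0 <= f i)%E) -> (forall i, S i -> ~ F i -> f i = 0%E) ->
  (\esum_(i in S) f i = \sum_(i \in F) f i)%E.
Proof.
move=> finF FS f0 fN0.
have f0S i : S i -> (0 <= f i)%E.
  by move=> Si; have [/f0//|/(fN0 _ Si) ->] := pselect (F i).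
rewrite (esumID F)// (setIidr FS) [X in (_ + X)%E]esum1 ?adde0; last first.
  by move=> i [Si nFi]; exact: fN0.
by rewrite esum_fset// => i; rewrite inE; exact: f0.
Qed.

(** A signed sum can be computed from any difference of summable nonnegative
families, not only from the positive and negative parts; linearity follows. *)
Lemma rsum_diff S f g h :
  (forall i, S i -> f i = g i - h i) ->
  (forall i, S i -> 0 <= g i) -> (forall i, S i -> 0 <= h i) ->
  (\esum_(i in S) (g i)%:E < +oo)%E -> (\esum_(i in S) (h i)%:E < +oo)%E ->
  rsum S f = fine (\esum_(i in S) (g i)%:E) - fine (\esum_(i in S) (h i)%:E).
Proof.
move=> fgh g0 h0 goo hoo; rewrite /rsum.
have sg : summable S (EFin \o g).
  rewrite /summable (eq_esum (b := EFin \o g))// => i Si /=.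
  by rewrite ger0_norm ?g0.
have sh : summable S (EFin \o h).
  rewrite /summable (eq_esum (b := EFin \o h))// => i Si /=.
  by rewrite ger0_norm ?h0.
rewrite (eq_esum (b := ((EFin \o g) \- (EFin \o h))%E^\+)%E); last first.
  by move=> i Si; rewrite !funeposE/= fgh.
rewrite (eq_esum (I := S) (a := (EFin \o f)^\-%E)
  (b := ((EFin \o g) \- (EFin \o h))%E^\-)%E); last first.
  by move=> i Si; rewrite !funenegE/= fgh.
rewrite esumB// fineB// ge0_fin_numE//; apply: esum_ge0 => i Si /=;
  by rewrite lee_fin ?g0 ?h0.
Qed.

Let abs_le_esum S f (g : T -> R) : (forall i, S i -> 0 <= f i <= g i) ->
  (\esum_(i in S) (g i)%:E < +oo)%E -> (\esum_(i in S) (f i)%:E < +oo)%E.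
Proof.
move=> fg; apply: le_lt_trans; apply: le_esum => i /fg/andP[_].
by rewrite lee_fin.
Qed.

Let pos f i := Num.max (f i) 0.
Let neg f i := Num.max (- f i) 0.
Let posneg f i : f i = pos f i - neg f i.
Proof.
rewrite /pos /neg; have [f0|/ltW f0] := leP (f i) 0.
  by rewrite max_l ?oppr_ge0// sub0r opprK.
by rewrite max_r ?oppr_le0// subr0.
Qed.
Let pos_ge0 f i : 0 <= pos f i.
Proof. by rewrite /pos le_max lexx orbT. Qed.
Let neg_ge0 f i : 0 <= neg f i.
Proof. by rewrite /neg le_max lexx orbT. Qed.
Let pos_le f i : pos f i <= `|f i|.
Proof. by rewrite /pos ge_max ler_norm normr_ge0. Qed.
Let neg_le f i : neg f i <= `|f i|.
Proof. by rewrite /neg ge_max -normrN ler_norm normr_ge0. Qed.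
Let pos_lty S f : (\esum_(i in S) `|f i|%:E < +oo)%E ->
  (\esum_(i in S) (pos f i)%:E < +oo)%E.
Proof. by apply: abs_le_esum => i _; rewrite pos_ge0 pos_le. Qed.
Let neg_lty S f : (\esum_(i in S) `|f i|%:E < +oo)%E ->
  (\esum_(i in S) (neg f i)%:E < +oo)%E.
Proof. by apply: abs_le_esum => i _; rewrite neg_ge0 neg_le. Qed.

Lemma rsumE S f : (\esum_(i in S) `|f i|%:E < +oo)%E -> rsum S f =
  fine (\esum_(i in S) (Num.max (f i) 0)%:E) -
  fine (\esum_(i in S) (Num.max (- f i) 0)%:E).
Proof.
move=> foo; apply: rsum_diff => *; rewrite -?/(pos _ _) -?/(neg _ _) //.
  exact: pos_lty.
exact: neg_lty.
Qed.

Lemma eq_rsum S f g : (forall i, S i -> f i = g i) -> rsum S f = rsum S g.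
Proof.
move=> fg; rewrite /rsum; congr (fine (_ - _))%E; apply: eq_esum => i Si.
  by rewrite !funeposE/= fg.
by rewrite !funenegE/= fg.
Qed.

Lemma rsumD S f g :
  (\esum_(i in S) `|f i|%:E < +oo)%E -> (\esum_(i in S) `|g i|%:E < +oo)%E ->
  rsum S (fun i => f i + g i) = rsum S f + rsum S g.
Proof.
move=> foo goo.
have pD (p q : T -> R) : (forall i, 0 <= p i) -> (forall i, 0 <= q i) ->
    (\esum_(i in S) (p i)%:E < +oo)%E -> (\esum_(i in S) (q i)%:E < +oo)%E ->
    (\esum_(i in S) (p i + q i)%:E < +oo)%E /\
    fine (\esum_(i in S) (p i + q i)%:E) =
    fine (\esum_(i in S) (p i)%:E) + fine (\esum_(i in S) (q i)%:E).
  move=> p0 q0 poo qoo.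
  have -> : (\esum_(i in S) (p i + q i)%:E =
      (\esum_(i in S) (p i)%:E) + \esum_(i in S) (q i)%:E)%E.
    by rewrite -esumD// => i _; rewrite lee_fin.
  split; first exact: lte_add_pinfty.
  by rewrite fineD// ge0_fin_numE//; apply: esum_ge0 => i _; rewrite lee_fin.
have [poo pE] := pD _ _ (pos_ge0 f) (pos_ge0 g) (pos_lty foo) (pos_lty goo).
have [noo nE] := pD _ _ (neg_ge0 f) (neg_ge0 g) (neg_lty foo) (neg_lty goo).
rewrite (rsumE foo) (rsumE goo).
rewrite (@rsum_diff _ _ (fun i => pos f i + pos g i) (fun i => neg f i + neg g i))//.
- by rewrite pE nE opprD addrACA.
- by move=> i _; rewrite [in LHS](posneg f) [in LHS](posneg g); lra.
- by move=> i _; rewrite addr_ge0.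
- by move=> i _; rewrite addr_ge0.
Qed.

Lemma rsumN S f : (\esum_(i in S) `|f i|%:E < +oo)%E ->
  rsum S (fun i => - f i) = - rsum S f.
Proof.
move=> foo; rewrite (rsumE foo).
rewrite (@rsum_diff _ _ (neg f) (pos f)) ?opprB//.
- by move=> i _; rewrite [in LHS](posneg f) opprB.
- exact: neg_lty.
- exact: pos_lty.
Qed.

Lemma rsumZ S (k : R) f : (\esum_(i in S) `|f i|%:E < +oo)%E ->
  rsum S (fun i => k * f i) = k * rsum S f.
Proof.
have ge0 (l : R) g : 0 <= l -> (\esum_(i in S) `|g i|%:E < +oo)%E ->
    rsum S (fun i => l * g i) = l * rsum S g.
  move=> l0 goo.
  have lZ (p : T -> R) : (forall i, 0 <= p i) ->
      (\esum_(i in S) (p i)%:E < +oo)%E ->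
      (\esum_(i in S) (l * p i)%:E < +oo)%E /\
      fine (\esum_(i in S) (l * p i)%:E) = l * fine (\esum_(i in S) (p i)%:E).
    move=> p0 poo.
    have pfin : (\esum_(i in S) (p i)%:E)%E \is a fin_num.
      by rewrite ge0_fin_numE// esum_ge0// => i _; rewrite lee_fin.
    by rewrite esumZ// lte_mul_pinfty// fineM.
  have [poo pE] := lZ _ (pos_ge0 g) (pos_lty goo).
  have [noo nE] := lZ _ (neg_ge0 g) (neg_lty goo).
  rewrite (rsumE goo) mulrBr -pE -nE; apply: rsum_diff => // i _.
  - by rewrite [in LHS](posneg g) mulrBr.
  - by rewrite mulr_ge0 ?pos_ge0.
  - by rewrite mulr_ge0 ?neg_ge0.
move=> foo; have [k0|k0] := leP 0 k; first exact: ge0.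
have foo' : (\esum_(i in S) `|- f i|%:E < +oo)%E.
  by rewrite (eq_esum (b := fun i => `|f i|%:E))// => i _; rewrite normrN.
rewrite (eq_rsum (g := fun i => - k * - f i)); last by move=> i _; rewrite mulrNN.
by rewrite ge0 ?oppr_ge0 ?(ltW k0)// rsumN// mulrNN.
Qed.

End UnconditionalSums.

Section FiniteSupportSums.
Context {R : realType} {T : choiceType}.
Implicit Types (S F : set T).

Lemma fsum_EFin F (f : T -> R) : finite_set F ->
  (\sum_(i \in F) (f i)%:E = (\sum_(i \in F) f i)%:E)%E.
Proof. by move=> finF; rewrite !fsbig_finite//= sumEFin. Qed.

Lemma rsum_finite_support S F (f : T -> R) : finite_set F -> F `<=` S ->
  (forall i, S i -> ~ F i -> f i = 0) -> rsum S f = \sum_(i \in F) f i.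
Proof.
move=> finF FS f0.
have esumF (p : R -> R) : p 0 = 0 -> (forall x, 0 <= p x) ->
    (\esum_(i in S) (p (f i))%:E = (\sum_(i \in F) p (f i))%:E)%E.
  move=> p00 p0; rewrite (esum_finite_support finF FS) ?fsum_EFin//.
    by move=> i _; rewrite lee_fin.
  by move=> i Si nF; rewrite f0// p00.
rewrite rsumE; last by rewrite (esumF Num.norm) ?ltry ?normr0.
rewrite (esumF (fun x => Num.max x 0)) ?maxxx//; last first.
  by move=> x; rewrite le_max lexx orbT.
rewrite (esumF (fun x => Num.max (- x) 0)) ?oppr0 ?maxxx//; last first.
  by move=> x; rewrite le_max lexx orbT.
rewrite /= !fsbig_finite// -sumrB; apply: eq_bigr => i _.
have [i0|/ltW i0] := leP (f i) 0.
  by rewrite max_l ?oppr_ge0// sub0r opprK.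
by rewrite max_r ?oppr_le0// subr0.
Qed.

End FiniteSupportSums.

Section ComplexSums.
Context {R : realType} {T : choiceType}.
Implicit Types (S F : set T) (f g : T -> R[i]).
Local Open Scope complex_scope.

Definition csummable S f := (\esum_(i in S) (normc (f i))%:E < +oo)%E.

Lemma csummable_le S f (g : T -> R) :
  (forall i, S i -> normc (f i) <= g i) ->
  (\esum_(i in S) (g i)%:E < +oo)%E -> csummable S f.
Proof.
by move=> fg; apply: le_lt_trans; apply: le_esum => i /fg; rewrite lee_fin.
Qed.

Lemma csummable_Re S f : csummable S f ->
  (\esum_(i in S) `|complex.Re (f i)|%:E < +oo)%E.
Proof.
by apply: le_lt_trans; apply: le_esum => i _; rewrite lee_fin Re_le_normc.
Qed.

Lemma csummable_Im S f : csummable S f ->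
  (\esum_(i in S) `|complex.Im (f i)|%:E < +oo)%E.
Proof.
by apply: le_lt_trans; apply: le_esum => i _; rewrite lee_fin Im_le_normc.
Qed.

Lemma eq_csum S f g : (forall i, S i -> f i = g i) -> csum S f = csum S g.
Proof.
by move=> fg; rewrite /csum; congr (_ +i* _); apply: eq_rsum => i /fg ->.
Qed.

Lemma csumD S f g : csummable S f -> csummable S g ->
  csum S (fun i => f i + g i) = csum S f + csum S g.
Proof.
move=> sf sg; apply: complexP; rewrite ?ReD ?ImD /csum/=.
  rewrite -rsumD; [|exact: csummable_Re..].
  by apply: eq_rsum => i _; rewrite ReD.
rewrite -rsumD; [|exact: csummable_Im..].
by apply: eq_rsum => i _; rewrite ImD.
Qed.

Lemma csumZ S (a : R[i]) f : csummable S f ->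
  csum S (fun i => a * f i) = a * csum S f.
Proof.
move=> sf; have sR := csummable_Re sf; have sI := csummable_Im sf.
have sZ (k : R) (h : T -> R) : (\esum_(i in S) `|h i|%:E < +oo)%E ->
    (\esum_(i in S) `|k * h i|%:E < +oo)%E.
  move=> hoo; rewrite (eq_esum (b := fun i => (`|k| * `|h i|)%:E)); last first.
    by move=> i _; rewrite normrM.
  by rewrite esumZ// lte_mul_pinfty// ge0_fin_numE// esum_ge0.
apply: complexP; rewrite ?ReM ?ImM /csum/=.
  rewrite -mulNr -!rsumZ// -rsumD; [|exact: sZ..].
  by apply: eq_rsum => i _; rewrite ReM mulNr.
rewrite -!rsumZ// -rsumD; [|exact: sZ..].
by apply: eq_rsum => i _; rewrite ImM.
Qed.

Lemma csumJ S f : csummable S f ->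
  csum S (fun i => conjc (f i)) = conjc (csum S f).
Proof.
move=> sf; rewrite /csum/= -rsumN; last exact: csummable_Im.
by congr (_ +i* _); apply: eq_rsum => i _; case: (f i).
Qed.

Lemma csum_finite_support S F f : finite_set F -> F `<=` S ->
  (forall i, S i -> ~ F i -> f i = 0) -> csum S f = \sum_(i \in F) f i.
Proof.
move=> finF FS f0.
have ReS : complex.Re (\sum_(i \in F) f i) = \sum_(i \in F) complex.Re (f i).
  by rewrite !fsbig_finite//; apply: (big_morph _ (@ReD R) (erefl _)).
have ImS : complex.Im (\sum_(i \in F) f i) = \sum_(i \in F) complex.Im (f i).
  by rewrite !fsbig_finite//; apply: (big_morph _ (@ImD R) (erefl _)).
apply: complexP; rewrite ?ReS ?ImS /csum/=.
  by apply: rsum_finite_support => // i Si nF; rewrite f0.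
by apply: rsum_finite_support => // i Si nF; rewrite f0.
Qed.

End ComplexSums.

(** * The energy form *)

Section EnergyForm.
Context {R : realType} {V : countType} (N : network R V).
Local Open Scope complex_scope.
Local Notation FE := (finite_energy_fun N).

Definition energy_form (u v : FE) : R[i] := energy_ip N u v.

Let term (u v : V -> R[i]) (e : V * V) : R[i] :=
  (cond N e.1 e.2)%:C * (conjc (u e.1 - u e.2) * (v e.1 - v e.2)).

Let energy_ipE u v : energy_ip N u v = 2^-1 * csum (edges N) (term u v).
Proof. by []. Qed.

Let edge_cond_gt0 e : edges N e -> 0 < cond N e.1 e.2.
Proof. exact: cond_gt0. Qed.

Let csummable_term (u v : FE) : csummable (edges N) (term u v).
Proof.
have := fefunP u; have := fefunP v; rewrite !energy_lty => voo uoo.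
have := lte_add_pinfty uoo voo; rewrite -esumD.
- apply: csummable_le => e /edge_cond_gt0 c0.
  rewrite !normcM normcJ -mulrDr (_ : normc _%:C = cond N e.1 e.2); last first.
    by rewrite /= expr0n addr0 sqrtr_sqr gtr0_norm.
  rewrite ler_pM2l//; move: (normc _) (normc _) => a b.
  by have := sqr_ge0 (a - b); have := sqr_ge0 (a + b); nra.
- by move=> e /edge_cond_gt0 c0; rewrite lee_fin mulr_ge0 ?sqr_ge0 ?ltW.
- by move=> e /edge_cond_gt0 c0; rewrite lee_fin mulr_ge0 ?sqr_ge0 ?ltW.
Qed.

Let half_conj : conjc (2^-1 : R[i]) = 2^-1.
Proof. by rewrite (fmorphV (@conjc R)) (rmorph_nat (@conjc R)). Qed.

Let halfR : (2^-1 : R[i]) = (2^-1 : R)%:C.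
Proof. by rewrite fmorphV/= rmorph_nat. Qed.

(** The link between the signed sums of the inner product and the extended sum
defining the energy. *)
Lemma Re_energy_form (u : FE) :
  complex.Re (energy_form u u) = fine (energy N u).
Proof.
rewrite /energy_form energy_ipE halfR ReM ReR ImR mul0r subr0 /csum/=.
have te e : complex.Re (term u u e) =
    cond N e.1 e.2 * normc (u e.1 - u e.2) ^+ 2.
  by rewrite sqr_normc /term; case: (_ - _) => a b /=; ring.
have t0 e : edges N e -> 0 <= cond N e.1 e.2 * normc (u e.1 - u e.2) ^+ 2.
  by move=> /edge_cond_gt0 c0; rewrite mulr_ge0 ?sqr_ge0 ?ltW.
have := fefunP u; rewrite energy_lty => uoo.
have z0 : (\esum_(e in edges N) (0 : R)%:E = 0)%E by rewrite esum1.
rewrite (@rsum_diff _ _ _ _ (fun e => cond N e.1 e.2 * normc (u e.1 - u e.2) ^+ 2)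
  (fun=> 0))// ?z0 ?ltry//; last by move=> e _; rewrite te subr0.
rewrite subr0 /energy fineM// ge0_fin_numE//.
by apply: esum_ge0 => e /t0; rewrite lee_fin.
Qed.

Lemma energy_form_semi : semi_inner energy_form.
Proof.
split.
- move=> u v w; rewrite /energy_form !energy_ipE -mulrDr -csumD//.
  rewrite (@eq_csum _ _ _ _ (fun e => term u v e + term u w e))// => e _.
  by rewrite /term -!mulrDr opprD addrACA.
- move=> a u v; rewrite /energy_form !energy_ipE [RHS]mulrCA -(csumZ a)//.
  rewrite (@eq_csum _ _ _ _ (fun e => a * term u v e))// => e _.
  rewrite /term (_ : (a *: v) e.1 - (a *: v) e.2 = a * (v e.1 - v e.2)).
    by ring.
  by rewrite mulrBr.
- move=> u v; rewrite /energy_form !energy_ipE conjcM half_conj -csumJ//.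
  rewrite (@eq_csum _ _ _ _ (term v u))// => e _.
  rewrite /term; case: (u _ - _) => a b; case: (v _ - _) => c d.
  by apply: complexP; rewrite /=; ring.
- move=> u; rewrite Re_energy_form fine_ge0// /energy mule_ge0//.
  apply: esum_ge0 => e /edge_cond_gt0 c0.
  by rewrite lee_fin mulr_ge0 ?sqr_ge0 ?ltW.
Qed.

End EnergyForm.

Section Indicators.
Context {R : realType} {V : countType} (N : network R V).
Local Open Scope complex_scope.
Local Notation FE := (finite_energy_fun N).
Local Notation edges := (edges N).

Definition indic (x : V) : V -> R[i] := fun y => (y == x)%:R.

Let nbrs x := [set y | edge N x y].
(** Both orientations of the edges at x: the support of the increments of the
indicator of x. *)
Let star x : set (V * V) := ((pair x) @` nbrs x) `|` ((pair^~ x) @` nbrs x).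

Let star_finite x : finite_set (star x).
Proof. by rewrite finite_setU; split; apply: finite_image; exact: edge_fin. Qed.

Let star_edges x : star x `<=` edges.
Proof.
by move=> _ [] [y xy <-] //; rewrite /Defs.edges/= edge_sym.
Qed.

Let indic_star x e : edges e -> ~ star x e -> indic x e.1 - indic x e.2 = 0.
Proof.
case: e => y z /= yz nstar; rewrite /indic.
have [yx|_] := eqVneq y x; first by case: nstar; left; exists z; rewrite -?yx.
have [zx|_] := eqVneq z x; last by rewrite subrr.
by case: nstar; right; exists y; rewrite -?zx//; rewrite /nbrs/= edge_sym.
Qed.

Fact indic_energy x : indic x \in finite_energy N.
Proof.
rewrite energy_lty (esum_finite_support (star_finite x) (@star_edges x)).
- by rewrite fsum_EFin ?ltry.
- move=> e /star_edges/cond_gt0 c0.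
  by rewrite lee_fin mulr_ge0 ?sqr_ge0 ?ltW.
- by move=> e eE /indic_star -> //; rewrite normc0 expr0n mulr0.
Qed.

Definition delta (x : V) : FE := FiniteEnergyFun (indic_energy x).

(** The indicator of x represents the pointwise Laplacian at x: only the edges
at x contribute, each once per orientation, and the two orientations contribute
equally. *)
Lemma energy_form_delta x (u : FE) : energy_form (delta x) u = laplacian N u x.
Proof.
pose F y := (cond N x y)%:C * (u x - u y).
have sumF : \sum_(e \in star x) (cond N e.1 e.2)%:C *
    (conjc (indic x e.1 - indic x e.2) * (u e.1 - u e.2)) = 2 * laplacian N u x.
  rewrite fsbigU0//=; last 3 first.
  - by apply: finite_image; exact: edge_fin.
  - by apply: finite_image; exact: edge_fin.
  - by move=> [y z] /= [[y' _ [<- _]] [z' xz' [zz' _]]]; move: xz';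
      rewrite /nbrs/= zz' edge_irr.
  rewrite mulr_natl mulr2n /laplacian; congr (_ + _).
    rewrite fsbig_image; last by move=> y z _ _ [].
    apply: eq_fsbigr => y /[!inE] xy /=; congr (_ * _).
    rewrite /indic eqxx (_ : y == x = false) ?subr0 ?conjc1 ?mul1r//.
    by apply/eqP => yx; move: xy; rewrite /nbrs/= yx edge_irr.
  rewrite fsbig_image; last by move=> y z _ _ [].
  apply: eq_fsbigr => y /[!inE] xy /=; rewrite cond_sym ?[edge N y x]edge_sym//.
  congr (_ * _).
  rewrite /indic eqxx (_ : y == x = false).
    by rewrite sub0r (rmorphN1 (@conjc R)) mulN1r opprB.
  by apply/eqP => yx; move: xy; rewrite /nbrs/= yx edge_irr.
rewrite /energy_form /energy_ip (csum_finite_support (star_finite x) (@star_edges x)).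
  by rewrite sumF mulKf// pnatr_eq0.
by move=> e eE /indic_star -> //; rewrite (rmorph0 (@conjc R)) mul0r mulr0.
Qed.

End Indicators.

Section Evaluation.
Context {R : realType} {V : countType} (N : network R V).
Local Open Scope complex_scope.
Local Notation FE := (finite_energy_fun N).
Local Notation edges := (edges N).
Local Notation norm u := (hnorm (@energy_form R V N) u).

Lemma edge_sum_le_energy (u : FE) (F : set (V * V)) :
  finite_set F -> F `<=` edges ->
  \sum_(e \in F) cond N e.1 e.2 * normc (u e.1 - u e.2) ^+ 2 <= 2 * norm u ^+ 2.
Proof.
move=> finF FE; rewrite (sqr_hnorm (energy_form_semi N)) Re_energy_form.
have := fefunP u; rewrite energy_lty /energy; set E := (\esum_(e in _) _)%E => Eoo.
have E0 : (0 <= E)%E.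
  by apply: esum_ge0 => e /cond_gt0 c0; rewrite lee_fin mulr_ge0 ?sqr_ge0 ?ltW.
rewrite fineM// ?ge0_fin_numE//= mulrA divff ?pnatr_eq0// mul1r.
rewrite -lee_fin fineK ?ge0_fin_numE// -fsum_EFin//.
by apply: ereal_sup_ubound; exists F.
Qed.

(** Along a path from x to y each increment is controlled by the energy of one
edge; connectedness is what makes differences of values continuous. *)
Lemma evaluation_bounded (x y : V) :
  exists2 K : R, 0 <= K & forall u : FE, normc (u y - u x) <= K * norm u.
Proof.
have [p [+ <-]] := edge_connected N x y.
elim: p x => [|z p IHp] x /=.
  by exists 0 => // u; rewrite subrr normc0 mul0r.
move=> /andP[xz /IHp[K K0 HK]].
pose c := cond N x z; have c0 : 0 < c by exact: cond_gt0.
exists (K + Num.sqrt (2 / c)) => [|u]; first by rewrite addr_ge0 ?sqrtr_ge0.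
rewrite mulrDl (_ : _ - _ = (u (last z p) - u z) + (u z - u x)); last by ring.
apply: le_trans (normcD _ _) _; rewrite lerD//.
rewrite -(@ler_pXn2r _ 2)// ?nnegrE ?mulr_ge0 ?hnorm_ge0 ?normc_ge0 ?sqrtr_ge0//.
rewrite exprMn sqr_sqrtr ?divr_ge0 ?(ltW c0)// mulrAC ler_pdivlMr// mulrC normcB.
have := @edge_sum_le_energy u [set (x, z)] (finite_set1 _).
by rewrite fsbig_set1/=; apply => _ ->.
Qed.

End Evaluation.

(** * Existence of dipoles *)

Section Dipoles.
Context {R : realType} {V : countType} (N : network R V).
Local Open Scope complex_scope.
Local Notation FE := (finite_energy_fun N).
Local Notation edges := (edges N).
Local Notation norm u := (hnorm (@energy_form R V N) u).

(** Lower semicontinuity of the energy under pointwise convergence, by Fatou's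
argument on finite sets of edges.  This replaces completeness of the energy
space.  Values are normalized at o since the energy only sees differences. *)
Lemma energy_le_of_pointwise_limit (o : V) (f : nat -> FE) (g : V -> R[i])
    (B : nat -> R) (b : R) :
  (forall y (e : R), 0 < e -> exists M, forall n, (M <= n)%N ->
     normc (g y - (f n y - f n o)) < e) ->
  (forall n, norm (f n) ^+ 2 <= B n) -> B n @[n --> \oo] --> b ->
  exists u : FE, u = g :> (V -> R[i]) /\ norm u ^+ 2 <= b.
Proof.
move=> fg fB Bb.
have sum_le (F : set (V * V)) : finite_set F -> F `<=` edges ->
    \sum_(e \in F) cond N e.1 e.2 * normc (g e.1 - g e.2) ^+ 2 <= 2 * b.
  move=> finF FE; rewrite fsbig_finite//.
  have lhs : \sum_(e <- finmap.enum_fset (fset_set F)) cond N e.1 e.2 *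
      normc (f n e.1 - f n e.2) ^+ 2 @[n --> \oo] -->
      \sum_(e <- finmap.enum_fset (fset_set F))
        cond N e.1 e.2 * normc (g e.1 - g e.2) ^+ 2.
    apply: cvg_big => [|e _]; first exact: add_continuous.
    apply: cvgM; first exact: cvg_cst.
    apply: cvg_sqr_normc => r r0; have r2 : 0 < r / 2 by rewrite divr_gt0.
    have [M1 HM1] := fg e.1 _ r2; have [M2 HM2] := fg e.2 _ r2.
    exists (maxn M1 M2) => n; rewrite geq_max => /andP[/HM1 n1 /HM2 n2].
    have -> : g e.1 - g e.2 - (f n e.1 - f n e.2) =
      (g e.1 - (f n e.1 - f n o)) + (f n e.2 - f n o - g e.2) by ring.
    by apply: le_lt_trans (normcD _ _) _; rewrite [normc (_ - g _)]normcB; lra.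
  have rhs : 2 * B n @[n --> \oo] --> 2 * b by apply: cvgM => //; exact: cvg_cst.
  apply: (ler_cvg_to lhs rhs); apply: nearW => n; rewrite -fsbig_finite//.
  by apply: le_trans (edge_sum_le_energy _ finF FE) _; rewrite ler_pM2l.
have esum_le : (\esum_(e in edges)
    (cond N e.1 e.2 * normc (g e.1 - g e.2) ^+ 2)%:E <= (2 * b)%:E)%E.
  apply: ge_ereal_sup => _ [F [finF FE] <-].
  by rewrite fsum_EFin// lee_fin sum_le.
have gP : g \in finite_energy N.
  by rewrite energy_lty; apply: le_lt_trans esum_le _; rewrite ltry.
exists (FiniteEnergyFun gP); split => //.
rewrite (sqr_hnorm (energy_form_semi N)) Re_energy_form.
rewrite -lee_fin fineK; last first.
  by rewrite ge0_fin_numE// mule_ge0// esum_ge0// => e /cond_gt0 c0;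
    rewrite lee_fin mulr_ge0 ?sqr_ge0 ?ltW.
apply: (@le_trans _ _ (2^-1%:E * (2 * b)%:E)%E).
  by rewrite /energy lee_pmul2l ?lte_fin.
by rewrite -EFinM mulKf// pnatr_eq0.
Qed.

(** The dipole at x is a multiple of the function of least energy among those
with u x - u o = 1.  A minimizing sequence is Cauchy in energy, hence
pointwise, and its pointwise limit attains the infimum by lower
semicontinuity. *)
Lemma dipole_exists (o x : V) : x != o -> exists v, dipole N o x v.
Proof.
move=> xo; pose L (u : FE) := u x - u o.
have LD u v : L (u + v) = L u + L v by rewrite /L /= opprD addrACA.
have LZ a u : L (a *: u) = a * L u by rewrite /L mulrBr.
pose S := [set norm h ^+ 2 | h in [set h | L h = 1]].
have S_inf : has_inf S.
  split; last by exists 0 => _ [h _ <-]; exact: sqr_ge0.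
  exists (norm (delta N x) ^+ 2); exists (delta N x) => //=.
  by rewrite /L /= /indic eqxx eq_sym (negPf xo) subr0.
pose d := inf S.
have d_min h : L h = 1 -> d <= norm h ^+ 2.
  by move=> Lh; apply: ge_inf; [exact: S_inf.2|exists h].
have /choice[f fP] n : exists h : FE, L h = 1 /\ norm h ^+ 2 <= d + n.+1%:R^-1.
  have n0 : 0 < n.+1%:R^-1 :> R by rewrite invr_gt0.
  by have [_ [h Lh <-] /ltW] := inf_adherent n0 S_inf; exists h.
have semi := energy_form_semi N.
have cauchy_f y (e : R) : 0 < e -> exists M, forall n m,
    (M <= n)%N -> (M <= m)%N ->
    normc ((f n y - f n o) - (f m y - f m o)) < e.
  move=> e0; have [K K0 HK] := evaluation_bounded N o y.
  have r0 : 0 < (e / (K + 1)) ^+ 2 / 4.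
    by rewrite divr_gt0 ?exprn_gt0 ?divr_gt0// ltr_wpDl.
  (* The deviation r0 makes 2 / n.+1 + 2 / m.+1 smaller than (e / (K + 1)) ^+ 2. *)
  have [M _ HM] := near_infty_natSinv_lt (PosNum r0).
  exists M => n m /HM /= n1 /HM /= m1.
  have -> : f n y - f n o - (f m y - f m o) = (f n - f m) y - (f n - f m) o.
    by rewrite [RHS](_ : _ = (f n y - f m y) - (f n o - f m o))//; ring.
  apply: le_lt_trans (HK _) _.
  have : norm (f n - f m) < e / (K + 1).
    rewrite -(@ltr_pXn2r _ 2)// ?nnegrE ?hnorm_ge0 ?divr_ge0 ?addr_ge0 ?(ltW e0)//.
    apply: le_lt_trans (almost_minimizers_close semi LD LZ d_min
      (fP n).1 (fP m).1 (fP n).2 (fP m).2) _.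
    move: n1 m1 => /=; set r := (e / (K + 1)) ^+ 2.
    by set p := n.+1%:R^-1; set q := m.+1%:R^-1; lra.
  have K1 : 0 < K + 1 by rewrite ltr_wpDl.
  rewrite ltr_pdivlMr//; apply: le_lt_trans; rewrite mulrC.
  by rewrite ler_wpM2l ?hnorm_ge0// lerDl.
have /choice[g gP] y := complex_cauchy_cvg (cauchy_f y).
have g_cst y z : (forall n, f n y - f n o = z) -> g y = z.
  move=> fz; apply/eqP; rewrite -subr_eq0; apply/eqP/eq0_normc/eqP.
  rewrite eq_le normc_ge0 andbT leNgt; apply/negP => /(gP y)[M].
  by move=> /(_ M (leqnn M)); rewrite fz ltxx.
have go : g o = 0 by apply: g_cst => n; rewrite subrr.
have gx : g x = 1 by apply: g_cst => n; rewrite -(fP n).1.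
have Bd : d + n.+1%:R^-1 @[n --> \oo] --> d.
  rewrite -[X in _ --> X]addr0; apply: cvgD; first exact: cvg_cst.
  exact: cvg_harmonic.
have [m [mg m_le]] := energy_le_of_pointwise_limit gP (fun n => (fP n).2) Bd.
have Lm : L m = 1 by rewrite /L mg gx go subr0.
have m_min h : L h = 1 -> norm m ^+ 2 <= norm h ^+ 2.
  by move=> /d_min; exact: le_trans.
have repr_m := minimizer_represents semi LD LZ Lm m_min.
have mm : energy_form m m != 0.
  apply/eqP => mm0; have [K _ /(_ m)] := evaluation_bounded N o x.
  rewrite -/(L m) Lm normc1 /hnorm mm0 sqrtr0 mulr0.
  by rewrite leNgt ltr01.
exists (to_HE (conjc (energy_form m m)^-1 *: m)) => u.
rewrite ip_HE_to_HE -[LHS]/(energy_form _ u) (ipZl semi) conjcK (repr_m u).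
by rewrite mulrCA mulVf// mulr1.
Qed.

End Dipoles.

(** * The Laplacian on the span of the dipoles *)

Section LaplacianOperator.
Context {R : realType} {V : countType} (N : network R V).
Local Open Scope complex_scope.
Local Notation FE := (finite_energy_fun N).
Local Notation ip := (ip_HE N).
Local Notation A := (laplacian_HE N).

Lemma to_HEZ a (u : FE) : to_HE (a *: u) = a *: to_HE u.
Proof. exact: to_HE_scale. Qed.

Lemma to_HEB (u v : FE) : to_HE (u - v) = to_HE u - to_HE v.
Proof. by rewrite -scaleN1r to_HE_add to_HEZ scaleN1r. Qed.

Lemma ip_HE_semi : semi_inner ip.
Proof.
have semi := energy_form_semi N.
have ipE (u v : FE) : ip (to_HE u) (to_HE v) = energy_form u v.
  exact: ip_HE_to_HE.
split.
- move=> h k l; rewrite -(reprHE h) -(reprHE k) -(reprHE l) -to_HE_add !ipE.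
  exact: (ipDr semi).
- move=> a h k; rewrite -(reprHE h) -(reprHE k) -to_HEZ !ipE.
  exact: (ipZr semi).
- by move=> h k; rewrite -(reprHE h) -(reprHE k) !ipE; exact: (ipJ semi).
- by move=> h; rewrite -(reprHE h) ipE; exact: (ip_ge0 semi).
Qed.

(** Written with the inner product rather than with a representative, so that
it is visibly linear and well defined on classes; the next lemma identifies it
with the graph Laplacian. *)
Definition pointwise_laplacian (h : HE N) (x : V) : R[i] :=
  ip (to_HE (delta N x)) h.

Lemma pointwise_laplacianE (u : FE) x :
  pointwise_laplacian (to_HE u) x = laplacian N u x.
Proof.
by rewrite /pointwise_laplacian ip_HE_to_HE -energy_form_delta.
Qed.

Lemma laplacian_HE_eq (h : HE N) (f : FE) :
  (forall x, f x = pointwise_laplacian h x) -> A h = to_HE f.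
Proof.
move=> fh; rewrite /laplacian_HE; congr to_HE; apply: val_inj.
have -> : laplacian N (repr h) = f.
  by apply/funext => x; rewrite fh -[in RHS](reprHE h) pointwise_laplacianE.
by rewrite insubdK// fefunP.
Qed.

Variable o : V.
Local Notation D := (dipole_span N o).

(** By the reproducing property, the pairing of a dipole with the indicator of y
is read off the values of that indicator at x and o. *)
Lemma laplacian_dipole x v y : dipole N o x v ->
  pointwise_laplacian v y = delta N x y - delta N o y.
Proof.
move=> xv; rewrite /pointwise_laplacian -(ipJ ip_HE_semi) xv /= /indic.
by rewrite ![y == _]eq_sym (rmorphB (@conjc R)) !(rmorph_nat (@conjc R)).
Qed.

Lemma ip_sum_dipoles n (a : 'I_n -> R[i]) (x : 'I_n -> V) (v : 'I_n -> HE N)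
    (f : FE) : (forall i, dipole N o (x i) (v i)) ->
  ip (\sum_i a i *: v i) (to_HE f) = \sum_i conjc (a i) * (f (x i) - f o).
Proof.
move=> xv; rewrite (big_morph (fun h => ip h (to_HE f)) (id1 := 0) (op1 := +%R)).
- by apply: eq_bigr => i _; rewrite (ipZl ip_HE_semi) xv.
- by move=> h k; rewrite (ipDl ip_HE_semi).
- by rewrite -(ipJ ip_HE_semi) (ip0r ip_HE_semi) (rmorph0 (@conjc R)).
Qed.

Lemma laplacian_sum_dipoles n (a : 'I_n -> R[i]) (x : 'I_n -> V)
    (v : 'I_n -> HE N) y : (forall i, dipole N o (x i) (v i)) ->
  pointwise_laplacian (\sum_i a i *: v i) y =
  (\sum_i a i *: (delta N (x i) - delta N o)) y.
Proof.
move=> xv; rewrite /pointwise_laplacian.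
rewrite (big_morph (ip _) (id1 := 0) (op1 := +%R)); last exact: (ip0r ip_HE_semi).
  rewrite (big_morph (fun u : FE => u y) (id1 := 0) (op1 := +%R))//.
  apply: eq_bigr => i _; rewrite (ipZr ip_HE_semi).
  by rewrite -/(pointwise_laplacian _ _) (laplacian_dipole _ (xv i)).
by move=> h k; rewrite (ipDr ip_HE_semi).
Qed.

Lemma laplacian_HE_sum_dipoles n (a : 'I_n -> R[i]) (x : 'I_n -> V)
    (v : 'I_n -> HE N) : (forall i, dipole N o (x i) (v i)) ->
  A (\sum_i a i *: v i) = to_HE (\sum_i a i *: (delta N (x i) - delta N o)).
Proof.
by move=> xv; apply: laplacian_HE_eq => y; rewrite (laplacian_sum_dipoles _ _ xv).
Qed.

Lemma dipole_span_laplacian h : D h ->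
  exists f : FE, forall x, f x = pointwise_laplacian h x.
Proof.
move=> [n [a [x [v [xv ->]]]]].
exists (\sum_i a i *: (delta N (x i) - delta N o)) => y.
by rewrite (laplacian_sum_dipoles _ _ (fun i => (xv i).2)).
Qed.

(** Both sides are the same combination of the differences of the pointwise
Laplacian of k between x i and o: on the left because the Laplacian of a dipole
is a difference of indicators, on the right by the reproducing property.  The
constant c disappears in these differences. *)
Lemma laplacian_weak_adjoint h k (f : FE) (c : R[i]) : D h ->
  (forall x, f x = pointwise_laplacian k x + c) ->
  ip (A h) k = ip h (to_HE f).
Proof.
move=> [n [a [x [v [xv ->]]]]] fk.
have xv' i : dipole N o (x i) (v i) := (xv i).2.
rewrite (laplacian_HE_sum_dipoles _ xv') (ip_sum_dipoles _ _ xv').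
rewrite (big_morph (fun u : FE => ip (to_HE u) k) (id1 := 0) (op1 := +%R)).
- apply: eq_bigr => i _; rewrite to_HEZ (ipZl ip_HE_semi) to_HEB (ipBl ip_HE_semi).
  by rewrite !fk opprD addrACA subrr addr0.
- by move=> u w; rewrite to_HE_add (ipDl ip_HE_semi).
- rewrite -(ipJ ip_HE_semi) -(subrr (0 : FE)) to_HEB subrr (ip0r ip_HE_semi).
  by rewrite (rmorph0 (@conjc R)).
Qed.

(** For h a combination of dipoles, S y is the total coefficient at y and the
form is |sum of all a i|^2 plus the sum of |S y|^2 over the vertices y used,
that is, the squared l^2 norm of the Laplacian of h. *)
Lemma form_dipole_ge0 h : D h -> 0 <= complex.Re (ip h (A h)).
Proof.
move=> [n [a [x [v [xv ->]]]]].
have xv' i : dipole N o (x i) (v i) := (xv i).2.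
have xo i : x i == o = false := negbTE (xv i).1.
rewrite (laplacian_HE_sum_dipoles _ xv') (ip_sum_dipoles _ _ xv').
set f := \sum_i a i *: _.
pose S y := \sum_(i | x i == y) a i.
have fE y : f y = S y - (y == o)%:R * \sum_i a i.
  rewrite /f (big_morph (fun u : FE => u y) (id1 := 0) (op1 := +%R))//.
  rewrite /S [in X in X - _]big_mkcond mulr_sumr -sumrB; apply: eq_bigr => i _.
  rewrite -[LHS]/(a i * (indic (x i) y - indic o y)) /indic mulrBr [_ * a i]mulrC.
  by rewrite eq_sym; case: eqP; rewrite ?mulr1 ?mulr0.
have So : S o = 0 by rewrite /S big_pred0// => i; rewrite xo.
have -> : \sum_i conjc (a i) * (f (x i) - f o) =
    \sum_i conjc (a i) * S (x i) + conjc (\sum_i a i) * \sum_i a i.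
  rewrite (big_morph (@conjc R) (id1 := 0) (op1 := +%R) (@conjcD R))//.
    rewrite mulr_suml -big_split/=; apply: eq_bigr => i _.
    by rewrite !fE xo eqxx So mul0r mul1r subr0 sub0r opprK mulrDr.
  exact: (rmorph0 (@conjc R)).
have Re_conj_mul (z : R[i]) : 0 <= complex.Re (conjc z * z).
  by case: z => p q /=; nra.
rewrite ReD addr_ge0//.
(* Group the indices i according to the vertex x i. *)
rewrite (partition_big (fun i => SeqSub (codom_f x i)) xpredT)//=.
rewrite (big_morph _ (@ReD R) (erefl _)) sumr_ge0// => y _.
rewrite (eq_bigr (fun i => conjc (a i) * S (val y))); last first.
  by move=> i /eqP <-.
rewrite -mulr_suml (_ : \sum_(i | _) _ = conjc (S (val y)))//.
rewrite /S (big_morph (@conjc R) (id1 := 0) (op1 := +%R) (@conjcD R))//.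
exact: (rmorph0 (@conjc R)).
Qed.

Lemma laplacian_positive_symmetric : positive_symmetric ip D A.
Proof.
split.
- move=> _ _ [n [a [x [v [xv ->]]]]] [m [b [y [w [yw ->]]]]].
  exists (n + m)%N, (fun i => match fintype.split i with inl j => a j | inr k => b k end),
    (fun i => match fintype.split i with inl j => x j | inr k => y k end),
    (fun i => match fintype.split i with inl j => v j | inr k => w k end).
  split=> [i|]; first by case: fintype.split.
  rewrite big_split_ord; congr (_ + _); apply: eq_bigr => i _.
    by rewrite (unsplitK (inl i)).
  by rewrite (unsplitK (inr i)).
- move=> c _ [n [a [x [v [xv ->]]]]].
  exists n, (fun i => c * a i), x, v; split=> //.
  by rewrite scaler_sumr; apply: eq_bigr => i _; rewrite scalerA.
- move=> h k /dipole_span_laplacian[f fh] /dipole_span_laplacian[g gk].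
  rewrite (laplacian_HE_eq fh) (laplacian_HE_eq gk) -to_HE_add.
  apply: laplacian_HE_eq => y.
  by rewrite -[LHS]/(f y + g y) fh gk /pointwise_laplacian (ipDr ip_HE_semi).
- move=> c h /dipole_span_laplacian[f fh].
  rewrite (laplacian_HE_eq fh) -to_HEZ; apply: laplacian_HE_eq => y.
  by rewrite -[LHS]/(c * f y) fh /pointwise_laplacian (ipZr ip_HE_semi).
- move=> h k Dh /dipole_span_laplacian[f fk].
  rewrite (laplacian_HE_eq fk); apply/esym/(laplacian_weak_adjoint (c := 0)) => //.
  by move=> y; rewrite addr0 fk.
- exact: form_dipole_ge0.
Qed.

(** The adjoint of the Laplacian on the dipole span is the pointwise Laplacian:
testing against the dipole at x compares the values at x and at o, so the
existence of all dipoles determines the function up to a constant. *)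
Lemma adjoint_laplacianP (u g : FE) :
  (forall h, D h -> ip (A h) (to_HE u) = ip h (to_HE g)) <->
  exists c, forall x, g x = laplacian N u x + c.
Proof.
split=> [ug|[c gc] h Dh]; last first.
  by apply: (laplacian_weak_adjoint (c := c)) => // x; rewrite pointwise_laplacianE.
exists (g o - laplacian N u o) => x.
have [->|xo] := eqVneq x o; first by rewrite addrC subrK.
have [v xv] := dipole_exists N xo.
have Dv : D v.
  exists 1%N, (fun=> 1), (fun=> x), (fun=> v); split=> //.
  by rewrite big_ord1 scale1r.
have Av : A v = to_HE (delta N x - delta N o).
  by apply: laplacian_HE_eq => y; rewrite (laplacian_dipole _ xv).
have := ug _ Dv; rewrite Av xv to_HEB (ipBl ip_HE_semi).
rewrite -!/(pointwise_laplacian _ _) !pointwise_laplacianE => /eqP.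
by rewrite eq_sym subr_eq => /eqP ->; ring.
Qed.

End LaplacianOperator.

Theorem lemma6p5 (R : realType) (V : countType) (N : network R V) (o : V)
    (Vinf : infinite_set [set: V]) (u : V -> R[i]) :
  in_HE (friedrichs_domain (ip_HE N) (dipole_span N o)
           (laplacian_HE N)) u
  <->
  in_HE (form_completion (ip_HE N) (dipole_span N o)
           (laplacian_HE N)) u
  /\ in_HE [set: HE N] (laplacian N u).
Proof.
have semi := ip_HE_semi N; have pos := laplacian_positive_symmetric N o.
split=> [[f -> [w fw]]|[[f -> Qf] [g lapg _]]].
- have Qf : form_completion (ip_HE N) (dipole_span N o) (laplacian_HE N) (to_HE f).
    by have [] := fw.
  split; first by exists f.
  move: fw; rewrite -(reprHE w) => /(friedrichs_graphE semi pos _ Qf).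
  move=> /adjoint_laplacianP[c gc].
  have cP : (fun=> c) \in finite_energy N.
    rewrite energy_lty esum1 ?ltry// => e _.
    by rewrite subrr normc0 expr0n mulr0.
  exists (repr w - FiniteEnergyFun cP) => //.
  by apply/funext => x; rewrite -[RHS]/(repr w x - c) gc addrK.
- exists f => //; exists (to_HE g).
  apply/(friedrichs_graphE semi pos _ Qf)/adjoint_laplacianP.
  by exists 0 => x; rewrite addr0 lapg.
Qed.
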